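(* For $s\in\{1,3\}$ let $G_n^{1,s}$ be the graph obtained from $n$ disjoint hexagons $H_1,\dots,H_n$, where $H_i$ has vertices $v_i^1,\dots,v_i^6$ and edges $v_i^1v_i^2,v_i^2v_i^3,\dots,v_i^5v_i^6,v_i^6v_i^1$, by adding the edge $v_i^{s+1}v_{i+1}^1$ for $i=1,\dots,n-1$. Then $$\lim_{n\to\infty}\mathcal{I}(G_n^{1,1})=\frac{17r^2-13r+8}{3(7r^2-6r+3)},\qquad r=\frac{7+\sqrt[3]{262+6\sqrt{129}}+\sqrt[3]{262-6\sqrt{129}}}{3},$$ and $$\lim_{n\to\infty}\mathcal{I}(G_n^{1,3})=\frac{13r'^2+36r'+28}{3(5r'^2+16r'+12)},\qquad r'=\frac{5+\sqrt[3]{359+12\sqrt{78}}+\sqrt[3]{359-12\sqrt{78}}}{3}.$$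
   Context: For a finite simple graph $G$: a matching is a set of pairwise vertex-disjoint edges; it is maximal if not contained in a larger matching. $\nu(G)$ is the maximum matching size, $\mathcal{T}_0(G)$ the number of maximal matchings, $\mathcal{T}_1(G)$ the sum of the sizes of all maximal matchings, and $\mathcal{I}(G)=\frac{\mathcal{T}_1(G)}{\nu(G)\mathcal{T}_0(G)}$ (equal to $1$ by convention if $\nu(G)=0$). *)

(* Defs.v *)
From HB Require Import structures.
From mathcomp Require Import all_boot all_order all_algebra.
From mathcomp Require Import reals.

Set Implicit Arguments.
Unset Strict Implicit.
Unset Printing Implicit Defensive.

Import Order.TTheory GRing.Theory Num.Theory.

Record sgraph := SGraph {
  vertex :> finType;
  adj : rel vertex;
  adj_sym : symmetric adj;
  adj_irr : irreflexive adj
}.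

Section Matchings.
Variable G : sgraph.

Definition edges : {set {set G}} :=
  [set [set p.1; p.2] | p in [pred p : G * G | adj p.1 p.2]].

Definition matching (M : {set {set G}}) : bool :=
  (M \subset edges) && finset.trivIset M.

Definition maximal_matching (M : {set {set G}}) : bool :=
  matching M &&
    [forall N : {set {set G}}, matching N ==> ~~ (M \proper N)].

Definition matching_number : nat :=
  \max_(M : {set {set G}} | matching M) #|M|.

Definition nb_maximal_matchings : nat :=
  #|[set M : {set {set G}} | maximal_matching M]|.

Definition total_maximal_matchings : nat :=
  \sum_(M : {set {set G}} | maximal_matching M) #|M|.

Definition matching_ratio (R : realType) : R :=
  (if matching_number == 0%N then 1
   else total_maximal_matchings%:R
          / (matching_number%:R * nb_maximal_matchings%:R))%R.

End Matchings.

(* Indices are shifted by one: the pair (i, j) stands for v_{i+1}^{j+1}, so the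
   bridge v_i^{s+1} v_{i+1}^1 joins (i, s) to (i+1, 0). *)
Section HexChain.
Variables s n : nat.

Definition hex_arc (x y : 'I_n * 'I_6) : bool :=
  (x.1 == y.1) && (y.2 == x.2.+1 %% 6 :> nat).

Definition bridge_arc (x y : 'I_n * 'I_6) : bool :=
  [&& y.1 == x.1.+1 :> nat, x.2 == s :> nat & y.2 == 0 :> nat].

Definition hex_chain_adj (x y : 'I_n * 'I_6) : bool :=
  [|| hex_arc x y, hex_arc y x, bridge_arc x y | bridge_arc y x].

Lemma hex_chain_sym : symmetric hex_chain_adj.
Proof.
move=> x y; rewrite /hex_chain_adj.
by case: (hex_arc x y); case: (hex_arc y x);
   case: (bridge_arc x y); case: (bridge_arc y x).
Qed.

Lemma hex_chain_irr : irreflexive hex_chain_adj.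
Proof.
move=> [i j]; rewrite /hex_chain_adj /hex_arc /bridge_arc /=.
rewrite eqxx (ltn_eqF (ltnSn i)) /= !orbF orbb.
by case: j => [[|[|[|[|[|[|j]]]]]]].
Qed.

Definition hex_chain : sgraph := SGraph hex_chain_sym hex_chain_irr.

End HexChain.

(* Main.v *)
Require Import Defs.
From HB Require Import structures.
From mathcomp Require Import all_boot all_order all_algebra.
From mathcomp Require Import zify ring lra.

Set Implicit Arguments.
Unset Strict Implicit.
Unset Printing Implicit Defensive.

(** A maximal matching is a set of edges that are pairwise disjoint and meet
    every edge.  In the hexagon chain both conditions only involve consecutive
    hexagons, so the maximal matchings are the admissible words in the 2^7
    possible choices of edges of a hexagon and its outgoing bridge.  The words
    that may follow a letter depend only on one of three states: the bridge is
    used; it is not but the vertex it leaves from is covered; that vertex is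
    uncovered.  Hence the numbers v_n of words and the totals w_n of their
    sizes, indexed by the initial state, satisfy v_(n+1) = A v_n and
    w_(n+1) = A w_n + B v_n for 3 x 3 matrices A, B.  If r is the Perron
    eigenvalue of A with positive left and right eigenvectors l and h, then
    w_n / (n v_n) tends to (l B h) / (r l h) in each coordinate, while the
    matching number is 3 n.  In both cases r is the real root, given by
    Cardano's formula, of the characteristic polynomial of A. *)

(** * Maximal matchings as words *)

Section MaximalMatchings.
Variable G : sgraph.
Implicit Types (M N : {set {set G}}) (e f : {set G}).

Lemma edge_neq0 e : e \in edges G -> e != set0.
Proof.
by case/imsetP=> p _ ->; apply/set0Pn; exists p.1; rewrite !inE eqxx.
Qed.

Lemma card_edge e : e \in edges G -> #|e| = 2.
Proof.
case/imsetP=> p; rewrite inE => p12 ->; rewrite cards2.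
by case: eqVneq p12 => // ->; rewrite adj_irr.
Qed.

(** An edge meeting no edge of [M] could be added to it. Conversely, an edge outside [M] of a larger
    matching would meet an edge of [M], although both lie in that matching. *)
Lemma maximal_matchingE M :
  maximal_matching M = matching M &&
    [forall e in edges G, exists f in M, ~~ [disjoint e & f]].
Proof.
rewrite /maximal_matching; have [mM /=|//] := boolP (matching M).
case/andP: (mM) => sM tM; apply/forallP/forall_inP => [maxM e eE|domM N].
  apply: contraT; rewrite negb_exists_in => /forall_inP dis.
  have eM : e \notin M.
    apply/negP => /dis; rewrite negbK -setI_eq0 setIid.
    by apply/negP/edge_neq0.
  have /implyP := maxM (e |: M); rewrite properUr ?sub1set // => /(_ _)/negP-[] //.
  rewrite /matching subUset sub1set eE sM /=; apply/trivIsetP => a b.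
  rewrite !inE => /predU1P[->|aM] /predU1P[->|bM] nab.
  - by rewrite eqxx in nab.
  - by move: (dis _ bM); rewrite negbK.
  - by rewrite disjoint_sym; move: (dis _ aM); rewrite negbK.
  - exact: (trivIsetP tM).
apply/implyP => /andP[sN tN]; apply/negP => /properP[sMN [e eN eM]].
have /exists_inP[f fM] := domM e (subsetP sN e eN).
rewrite (trivIsetP tN) ?(subsetP sMN f) //.
by apply: contraNneq eM => ->.
Qed.

Lemma card_matching M : matching M -> #|M| * 2 <= #|G|.
Proof.
case/andP=> sM /eqP tM; rewrite -sum_nat_const.
rewrite (eq_bigr (fun e => #|e|)) ?tM ?max_card // => e eM.
by rewrite card_edge ?(subsetP sM).
Qed.

End MaximalMatchings.

(** A letter has one bit for each edge of a hexagon and one for its outgoing bridge. Nested pairs of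
    booleans let sums over the 128 letters be evaluated by computation. *)
Definition cfg : finType := (bool * (bool * (bool * (bool * (bool * (bool * bool))))))%type.

Definition bits (c : cfg) : seq bool :=
  let: (b0, (b1, (b2, (b3, (b4, (b5, b6)))))) := c in
  [:: b0; b1; b2; b3; b4; b5; b6].

Definition bit (c : cfg) (k : nat) : bool := nth false (bits c) k.

Definition mkcfg (f : nat -> bool) : cfg :=
  (f 0, (f 1, (f 2, (f 3, (f 4, (f 5, f 6)))))).

Definition weight (c : cfg) : nat := count id (bits c).

Lemma bit_mkcfg f k : k < 7 -> bit (mkcfg f) k = f k.
Proof. by case: k => [|[|[|[|[|[|[|]]]]]]]. Qed.

Lemma cfgP c d : (forall k, k < 7 -> bit c k = bit d k) -> c = d.
Proof.
case: c => [a0 [a1 [a2 [a3 [a4 [a5 a6]]]]]].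
case: d => [b0 [b1 [b2 [b3 [b4 [b5 b6]]]]]] e.
have := (e 0 isT, e 1 isT, e 2 isT, e 3 isT, e 4 isT, e 5 isT, e 6 isT).
by rewrite /bit /= => -[[[[[[-> ->] ->] ->] ->] ->] ->].
Qed.

Lemma weightE c : weight c = \sum_(k < 7) bit c k.
Proof.
case: c => [a0 [a1 [a2 [a3 [a4 [a5 a6]]]]]].
by rewrite /weight !big_ord_recl big_ord0 /bit /= /bump /= !addnA addn0.
Qed.

(* The pair [(i, k)] with [k < 6] stands for the edge of hexagon [i] starting at
   its vertex [k], and [(i, 6)] for the bridge from hexagon [i] to [i + 1]. *)
Definition ends (s : nat) (x : nat * nat) : seq (nat * nat) :=
  if x.2 < 6 then [:: x; (x.1, x.2.+1 %% 6)]
  else [:: (x.1, s); (x.1.+1, 0)].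

Definition meet (s : nat) (x y : nat * nat) : bool :=
  has (mem (ends s y)) (ends s x).

(** Incidence is invariant under translation along the chain, so hexagons 0 and 1 stand for any two
    consecutive ones. *)
Definition meet_same (s k l : nat) : bool := meet s (0, k) (0, l).
Definition meet_next (s k l : nat) : bool := meet s (0, k) (1, l).

Definition covers_exit (s : nat) (c : cfg) : bool :=
  has (fun l => bit c l && meet_same s 6 l) (iota 0 7).

(* The edges of a hexagon and of the next one, given by [p] and [c], are
   independent and dominate the edges of the second hexagon and the bridge. *)
Definition compatible (s : nat) (p c : cfg) : bool :=
  [&& all (fun k => all (fun l => [&& bit c k, bit c l & meet_same s k l] ==> (k == l))
             (iota 0 7)) (iota 0 7),
      all (fun l => ~~ [&& bit p 6, bit c l & meet_next s 6 l]) (iota 0 7),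
      all (fun k => has (fun l => bit c l && meet_same s k l) (iota 0 7)
                 || bit p 6 && meet_next s 6 k) (iota 0 6)
    & covers_exit s p || has (fun l => bit c l && meet_next s 6 l) (iota 0 7)].

(* Preceding the first hexagon by this letter imposes no constraint on it. *)
Definition start_cfg (s : nat) : cfg := mkcfg (eq_op s).

(** * The correspondence between maximal matchings and words *)

Section Chain.
Variables (s : nat).
Hypothesis s13 : (s == 1) || (s == 3).

Let cases7 (P : nat -> Prop) : 
  P 0 -> P 1 -> P 2 -> P 3 -> P 4 -> P 5 -> P 6 -> forall k, k < 7 -> P k.
Proof. by move=> ? ? ? ? ? ? ? [|[|[|[|[|[|[|]]]]]]]. Qed.

(** An edge of index [i] has its endpoints in hexagons [i] and [i + 1], the latter only at vertex 0,
    so the indices of meeting edges differ by at most one. *)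
Lemma meetE i j k l : k < 7 -> l < 7 ->
  meet s (i, k) (j, l) =
  [|| (j == i) && meet_same s k l, (j == i.+1) && meet_next s k l
    | (i == j.+1) && meet_next s l k].
Proof.
move=> k7 l7; move: k k7 l l7; case/orP: s13 => /eqP ->; apply: cases7; apply: cases7;
  rewrite /meet_same /meet_next /meet /ends /= !inE !xpair_eqE /=; lia.
Qed.

(** Only the bridge reaches the next hexagon, at vertex 0; since [s] is not 0, the following bridge
    does not start there. *)
Lemma meet_nextP k l : k < 7 -> l < 7 -> meet_next s k l -> k = 6 /\ l < 6.
Proof.
by move=> k7 l7; move: k k7 l l7; case/orP: s13 => /eqP ->; apply: cases7; apply: cases7.
Qed.

Lemma ends_inj i j k l : k < 7 -> l < 7 ->
  ends s (i, k) =i ends s (j, l) -> (i, k) = (j, l).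
Proof.
move=> k7 l7 e.
(* One inclusion is enough, since every edge has two distinct endpoints. *)
have {e}: all (mem (ends s (j, l))) (ends s (i, k)).
  by apply/allP => x; rewrite e.
move: k k7 l l7; case/orP: s13 => /eqP ->; apply: cases7; apply: cases7;
  rewrite /ends /= !inE !xpair_eqE /= => H; try congr (_, _); lia.
Qed.


Variable m : nat.
Let n := m.+1.
Let V : finType := ('I_n * 'I_6)%type.
Let E : finType := ('I_n * 'I_7)%type.
Local Notation G := (hex_chain s n).

Definition npair a b (x : 'I_a * 'I_b) : nat * nat := (x.1 : nat, x.2 : nat).

Lemma npair_inj a b : injective (@npair a b).
Proof. by move=> [i j] [k l] [/val_inj-> /val_inj->]. Qed.

Definition edge_of (x : E) : {set G} := [set v : V | npair v \in ends s (npair x)].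

(* The bridge leaving the last hexagon has no second endpoint. *)
Definition real_edge (x : E) : bool := (x.2 < 6) || (x.1 < m).

Lemma endsP x y : real_edge x -> y \in ends s (npair x) ->
  exists v : V, npair v = y.
Proof.
case: x => i k; rewrite /real_edge /= => xE yx.
suff /andP[y1 y2] : (y.1 < n) && (y.2 < 6).
  by exists (Ordinal y1, Ordinal y2); case: y {yx} y1 y2.
move: yx; rewrite /ends /=; case: ifP xE => /= k6 => [_|im].
  by rewrite !inE => /orP[]/eqP-> /=; rewrite ltn_ord ?ltn_pmod.
by rewrite !inE => /orP[]/eqP-> /=; [case/orP: s13 => /eqP->; rewrite ltn_ord|
  rewrite andbT; exact: im].
Qed.

(** A common endpoint is an endpoint of the real edge [x], hence comes from an actual vertex. *)
Lemma edge_of_meet x y : real_edge x ->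
  ~~ [disjoint edge_of x & edge_of y] = meet s (npair x) (npair y).
Proof.
move=> xE; apply/pred0Pn/hasP => [[v /andP[/=]]|[v vx vy]].
  by rewrite !inE => vx vy; exists (npair v).
have [u uv] := endsP xE vx.
by exists u; rewrite /= !inE uv vx.
Qed.

Lemma edge_of_inj : {in real_edge &, injective edge_of}.
Proof.
move=> x y xE yE /setP e; apply: npair_inj; apply: ends_inj => // v.
by apply/idP/idP => h; [have [u uv] := endsP xE h|have [u uv] := endsP yE h];
  move: (e u); rewrite !inE uv h.
Qed.

Lemma edges_hex_chain : edges G = [set edge_of x | x in real_edge].
Proof.
apply/setP => e; apply/imsetP/imsetP => [[[u v]]|[[i k]]].
  rewrite inE /= => uv ->.
  have arcE (a b : V) : hex_arc a b ->
      exists2 x, x \in real_edge & [set a; b] = edge_of x.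
    case: a b => [i k] [j l] /andP[/= /eqP<- /eqP el].
    exists (i, widen_ord (isT : 6 <= 7) k); first by rewrite unfold_in /real_edge /= ltn_ord.
    apply/setP => -[a b]; rewrite !inE /ends /= ltn_ord !inE -!(inj_eq (@npair_inj _ _)).
    by rewrite /npair /= el.
  have brE (a b : V) : bridge_arc s a b ->
      exists2 x, x \in real_edge & [set a; b] = edge_of x.
    case: a b => [i k] [j l] /and3P[/= /eqP ej /eqP ek /eqP el].
    exists (i, ord_max).
      by rewrite unfold_in /real_edge /= -ltnS -/n -ej ltn_ord.
    apply/setP => -[a b]; rewrite !inE /ends /= ?inE -!(inj_eq (@npair_inj _ _)).
    by rewrite /npair /= ej ek el.
  case/or4P: uv => [/arcE|/arcE|/brE|/brE] //; by rewrite setUC.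
rewrite unfold_in => xE ->; have [k6|k6] := ltnP k 6.
  exists ((i, Ordinal k6), (i, inord (k.+1 %% 6))).
    by rewrite inE /= /hex_chain_adj /hex_arc /= eqxx inordK ?ltn_pmod // eqxx.
  apply/setP => -[a b]; rewrite !inE /ends /= k6 !inE -!(inj_eq (@npair_inj _ _)).
  by rewrite /npair /= inordK ?ltn_pmod.
move: xE; rewrite /real_edge /= ltnNge k6 /= => im.
have s6 : s < 6 by case/orP: s13 => /eqP->.
exists ((i, Ordinal s6), (inord i.+1, ord0)).
  by rewrite inE /= /hex_chain_adj /bridge_arc /= inordK // !eqxx !orbT.
apply/setP => -[a b]; rewrite !inE /ends /= ltnNge k6 /= !inE -!(inj_eq (@npair_inj _ _)).
by rewrite /npair /= inordK.
Qed.

Definition edge_set (S : {set E}) : {set {set G}} := edge_of @: S.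

Lemma matching_edge_set (S : {set E}) : {subset S <= real_edge} ->
  matching (edge_set S) =
  [forall x in S, forall y in S, meet s (npair x) (npair y) ==> (x == y)].
Proof.
move=> SE; rewrite /matching edges_hex_chain.
have -> /= : edge_set S \subset [set edge_of x | x in real_edge].
  by apply/subsetP => _ /imsetP[x xS ->]; apply: imset_f; apply: SE.
apply/trivIsetP/forall_inP => [t x xS|t _ _ /imsetP[x xS ->] /imsetP[y yS ->] exy].
  apply/forall_inP => y yS; apply/implyP; rewrite -edge_of_meet; last exact: SE.
  apply: contraR => nxy; apply: t; rewrite ?imset_f //.
  by apply: contraNneq nxy => /edge_of_inj->; rewrite //; apply: SE.
apply: contraR exy; rewrite edge_of_meet; last exact: SE.
by move: (t x xS) => /forall_inP/(_ _ yS)/implyP h /h/eqP->.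
Qed.

Lemma maximal_edge_set (S : {set E}) : {subset S <= real_edge} ->
  maximal_matching (edge_set S) =
  [forall x in S, forall y in S, meet s (npair x) (npair y) ==> (x == y)] &&
  [forall x in real_edge, exists y in S, meet s (npair x) (npair y)].
Proof.
move=> SE; rewrite maximal_matchingE matching_edge_set //; congr (_ && _).
rewrite edges_hex_chain; apply/forall_inP/forall_inP => h x.
  move=> xE; have /exists_inP[_ /imsetP[y yS ->]] := h _ (imset_f edge_of xE).
  by rewrite edge_of_meet // => xy; apply/exists_inP; exists y.
case/imsetP=> y yE ->; have /exists_inP[z zS yz] := h _ yE.
apply/exists_inP; exists (edge_of z); first exact: imset_f.
by rewrite edge_of_meet.
Qed.

Lemma card_edge_set (S : {set E}) : {subset S <= real_edge} -> #|edge_set S| = #|S|.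
Proof.
by move=> SE; apply: card_in_imset => x y /SE xE /SE yE; apply: edge_of_inj.
Qed.

Lemma matching_number_hex_chain : matching_number G = 3 * n.
Proof.
apply/eqP; rewrite eqn_leq; apply/andP; split.
  apply/bigmax_leqP => M /card_matching.
  rewrite card_prod !card_ord; lia.
(* The edges 0, 2, 4 of all hexagons form a perfect matching, which attains the bound given by the
   number of vertices. *)
pose S : {set E} := [set x : E | (x.2 : nat) \in [:: 0; 2; 4]].
have SE : {subset S <= real_edge}.
  by move=> [i k]; rewrite !inE unfold_in /real_edge /= => /or3P[]/eqP->.
have -> : 3 * n = #|edge_set S|.
  rewrite card_edge_set // mulnC.
  have -> : S = setX [set: 'I_n] [set k : 'I_7 | (k : nat) \in [:: 0; 2; 4]].
    by apply/setP => -[i k]; rewrite !inE.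
  rewrite cardsX cardsT card_ord; congr (_ * _).
  by rewrite -sum1_card big_mkcond !big_ord_recl big_ord0 /= !inE.
apply: leq_bigmax_cond; rewrite matching_edge_set //.
apply/forall_inP => -[i k] kS; apply/forall_inP => -[j l] lS; apply/implyP.
rewrite meetE //= => h.
suff [/val_inj-> /val_inj->] : (i = j :> nat) /\ (k = l :> nat) by [].
move: kS lS h; rewrite !inE /=; case/orP: s13 => /eqP->;
  by move=> /or3P[]/eqP-> /or3P[]/eqP->;
  rewrite /meet_same /meet_next /= ?(andbT, andbF, orbF) // => /eqP->.
Qed.

Implicit Type w : n.-tuple cfg.

Definition word_set w : {set E} :=
  [set x : E | real_edge x && bit (tnth w x.1) x.2].

Definition set_word (M : {set {set G}}) : n.-tuple cfg :=
  [tuple mkcfg (fun k => real_edge (i, inord k) && (edge_of (i, inord k) \in M)) | i < n].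

(** No edge corresponds to the bridge bit of the last letter; fixing it makes the encoding of edge
    sets by words unique. *)
Definition closed_word w : bool := ~~ bit (last (start_cfg s) w) 6.

Lemma word_set_real w : {subset word_set w <= real_edge}.
Proof. by move=> x; rewrite inE => /andP[]. Qed.

Lemma set_wordK (M : {set {set G}}) :
  M \subset edges G -> edge_set (word_set (set_word M)) = M.
Proof.
rewrite edges_hex_chain => /subsetP sM; apply/setP => e; apply/imsetP/idP => [[[i k]]|eM].
  by rewrite inE /= tnth_mktuple bit_mkcfg // inord_val => /and3P[_ _ h ->].
have /imsetP[[i k] xE ee] := sM _ eM; exists (i, k) => //.
by rewrite inE /= tnth_mktuple bit_mkcfg // inord_val -ee eM andbT andbb.
Qed.

(** [set_word] never sets the bit of the missing bridge, and this bit is all that [word_set]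
    forgets. The equality of booleans is the side condition produced by reindexing a sum over
    matchings by words. *)
Lemma word_setK w : (set_word (edge_set (word_set w)) == w) = closed_word w.
Proof.
have lastE : last (start_cfg s) w = tnth w ord_max.
  by rewrite (last_nth (start_cfg s)) size_tuple (tnth_nth (start_cfg s)).
apply/eqP/idP => [<-|cw].
  rewrite /closed_word.
  rewrite (last_nth (start_cfg s)) size_tuple /=.
  have -> : nth (start_cfg s) (set_word (edge_set (word_set w))) m =
    tnth (set_word (edge_set (word_set w))) ord_max by rewrite (tnth_nth (start_cfg s)).
  by rewrite tnth_mktuple bit_mkcfg // /real_edge /= ltnn orbF inordK.
apply: eq_from_tnth => i; apply: cfgP => k k7.
rewrite tnth_mktuple bit_mkcfg //.
have [xE|] /= := boolP (real_edge _).
  apply/imsetP/idP => [[y yw e]|bw].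
    move: (yw); rewrite inE => /andP[yE].
    by rewrite -(edge_of_inj xE yE e) /= inordK.
  by exists (i, inord k); rewrite // inE xE /= inordK.
rewrite /real_edge /= inordK // negb_or -leqNgt -leqNgt => /andP[k6 im].
apply/esym/negbTE.
have -> : k = 6 by lia.
suff -> : i = ord_max by rewrite -lastE.
by apply: val_inj; apply/eqP; rewrite eqn_leq im -ltnS ltn_ord.
Qed.


(** By [meetE] all conditions are local: [compatible] for a letter and its predecessor collects
    those inside one hexagon and those around its incoming bridge. *)
Lemma path_maximal w : closed_word w ->
  maximal_matching (edge_set (word_set w)) = path (compatible s) (start_cfg s) w.
Proof.
move=> cw; rewrite maximal_edge_set; last exact: word_set_real.
set p0 := start_cfg s; pose g i := nth p0 w i.
(* [pr i] is the letter preceding [g i], with the start letter in front of the first hexagon. *)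
pose pr i := nth p0 (p0 :: w) i.
have s6 : s < 6 by case/orP: s13 => /eqP->.
have p0E k : k < 7 -> bit p0 k = (s == k) by exact: bit_mkcfg.
have gm : bit (g m) 6 = false.
  by apply/negbTE; move: cw; rewrite /closed_word (last_nth p0) size_tuple.
have inS i k (im : i < n) (k7 : k < 7) :
    ((Ordinal im, Ordinal k7) \in word_set w) = bit (g i) k.
  rewrite inE /= (tnth_nth p0) /= -/(g i) /real_edge /=.
  apply: andb_idl => b; rewrite -implyNb; apply/implyP; rewrite -leqNgt => k6.
  have k6' : k = 6 by lia.
  rewrite ltn_neqAle -ltnS im andbT; apply: contraTneq b => ->.
  by rewrite k6' gm.
have SP (x : E) : x \in word_set w ->
    exists i k, [/\ i < n, k < 7, npair x = (i, k) & bit (g i) k].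
  case: x => i k; rewrite inE (tnth_nth p0) => /andP[_ b].
  by exists i, k.
have npairE i k (im : i < n) (k7 : k < 7) : npair (Ordinal im, Ordinal k7) = (i, k) by [].
(* The start letter uses no bridge, as [s] is not 6, so a used incoming bridge comes from an actual
   hexagon. *)
have prS i : bit (pr i) 6 -> exists2 j, i = j.+1 & bit (g j) 6.
  by case: i => [|j]; [rewrite p0E // => /eqP; lia|exists j].
apply/andP/(pathP p0) => [[/forall_inP ind /forall_inP dom] i|cp].
  rewrite size_tuple -/(pr i) -/(g i) => im.
  apply/and4P; split.
  - apply/allP => k; rewrite mem_iota => /andP[_ k7].
    apply/allP => l; rewrite mem_iota => /andP[_ l7].
    apply/implyP => /and3P[bk bl kl].
    have kS := inS _ _ im k7; have lS := inS _ _ im l7.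
    rewrite bk in kS; rewrite bl in lS.
    have /forall_inP/(_ _ lS) := ind _ kS.
    by rewrite /npair /= meetE // eqxx kl /= => /eqP[->].
  - apply/allP => l; rewrite mem_iota => /andP[_ l7].
    apply/negP => /and3P[/prS[j ij bj] bl kl].
    have jm : j < n by lia.
    have kS := inS _ 6 jm isT; have lS := inS _ _ im l7.
    rewrite bj in kS; rewrite bl in lS.
    have /forall_inP/(_ _ lS) := ind _ kS.
    rewrite /npair /= meetE // kl (_ : i == j.+1) ?ij // orbT /= => /eqP[]; lia.
  - apply/allP => k; rewrite mem_iota => /andP[_ k6].
    have k7 : k < 7 by lia.
    have xE : (Ordinal im, Ordinal k7) \in real_edge by rewrite unfold_in /real_edge /= k6.
    have /exists_inP[y yS] := dom _ xE.
    have [j [l [jm l7 -> bl]]] := SP _ yS.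
    rewrite npairE meetE // => /or3P[]/andP[/eqP ij kl].
    + by apply/orP; left; apply/hasP; exists l; rewrite ?mem_iota // -ij bl.
    + have [] := meet_nextP k7 l7 kl; lia.
    + have [l6 _] := meet_nextP l7 k7 kl; rewrite l6 in bl kl.
      by rewrite ij [pr _]/(g j) bl kl orbT.
  (* No bridge enters the first hexagon; there the condition holds because edge [s] of the start
     letter covers the exit vertex. *)
  - case: i im => [|i] im.
      apply/orP; left; apply/hasP; exists s; first by rewrite mem_iota /=; lia.
      by rewrite /pr /= p0E ?eqxx; [case/orP: s13 => /eqP->|lia].
    have im' : i < n by lia.
    have xE : (Ordinal im', Ordinal (isT : 6 < 7)) \in real_edge
      by rewrite unfold_in /real_edge /=.
    have /exists_inP[y yS] := dom _ xE.
    have [j [l [jm l7 -> bl]]] := SP _ yS.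
    rewrite npairE meetE // => /or3P[]/andP[/eqP ij kl].
    + by apply/orP; left; apply/hasP; exists l; rewrite ?mem_iota // /pr /= -/(g i) -ij bl.
    + by apply/orP; right; apply/hasP; exists l; rewrite ?mem_iota // -ij bl.
    + by have [] := meet_nextP l7 (isT : 6 < 7) kl; lia.
have {}cp i : i < n -> compatible s (pr i) (g i) by move=> im; apply: cp; rewrite size_tuple.
split; apply/forall_inP => x.
  move=> xS; apply/forall_inP => y yS.
  rewrite -(inj_eq (@npair_inj _ _)).
  have [i [k [im k7 -> bk]]] := SP _ xS; have [j [l [jm l7 -> bl]]] := SP _ yS.
  have [ci cj] := (cp _ im, cp _ jm).
  apply/implyP; rewrite meetE // => /or3P[]/andP[/eqP ij kl].
  - case/and4P: ci => /allP/(_ k) + _ _ _; rewrite mem_iota => /(_ k7) /allP/(_ l).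
    by rewrite mem_iota => /(_ l7); rewrite bk -ij bl kl /= => /eqP->.
  - have [k6 _] := meet_nextP k7 l7 kl; rewrite k6 in bk kl.
    case/and4P: cj => _ /allP/(_ l) + _ _; rewrite mem_iota => /(_ l7).
    by rewrite bl kl ij [pr _]/(g i) bk.
  - have [l6 _] := meet_nextP l7 k7 kl; rewrite l6 in bl kl.
    case/and4P: ci => _ /allP/(_ k) + _ _; rewrite mem_iota => /(_ k7).
    by rewrite bk kl ij [pr _]/(g j) bl.
case: x => i0 k0; rewrite unfold_in /real_edge /npair /=.
move: (nat_of_ord i0) (ltn_ord i0) (nat_of_ord k0) (ltn_ord k0) => i im k k7 xE.
have [k6|k6] := ltnP k 6.
  case/and4P: (cp _ im) => _ _ /allP/(_ k) + _; rewrite mem_iota => /(_ k6).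
  case/orP => [/hasP[l]|/andP[/prS[j ij bj] kl]]; last first.
    have jm : j < n by lia.
    apply/exists_inP; exists (Ordinal jm, Ordinal (isT : 6 < 7)); first by rewrite inS.
    by rewrite meetE //= ij eqxx kl !orbT.
  rewrite mem_iota => /andP[_ l7] /andP[bl kl]; apply/exists_inP.
  exists (Ordinal im, Ordinal l7); first by rewrite inS.
  by rewrite meetE //= eqxx kl.
(* Domination of a bridge is expressed in the compatibility of its letter with the next one, which
   exists because the bridge is real. *)
have {k7 k6} k6 : k = 6 by lia.
rewrite k6 in xE *.
have im' : i.+1 < n by exact: xE.
case/and4P: (cp _ im') => _ _ _.
case/orP => /hasP[l]; rewrite mem_iota => /andP[_ l7] /andP[bl kl]; apply/exists_inP.
  exists (Ordinal im, Ordinal l7); first by rewrite inS.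
  by rewrite meetE //= eqxx kl.
exists (Ordinal im', Ordinal l7); first by rewrite inS.
by rewrite meetE //= eqxx kl orbT.
Qed.

Lemma card_word_set w : closed_word w -> #|edge_set (word_set w)| = \sum_(c <- w) weight c.
Proof.
move=> cw; rewrite card_edge_set; last exact: word_set_real.
rewrite big_tuple -sum1_card big_mkcond /=.
rewrite (eq_bigr (fun x => nat_of_bool ((x.1, x.2) \in word_set w))); last first.
  by case=> i k _; case: ifP.
rewrite -(pair_bigA _ (fun i k => nat_of_bool ((i, k) \in word_set w))) /=.
apply: eq_bigr => i _.
rewrite weightE; apply: eq_bigr => k _; rewrite inE /real_edge /=.
case: (boolP (bit _ _)) => b; last by rewrite andbF.
rewrite andbT; case: ltnP => //= k6; case: ltnP => // im.
move: cw; rewrite /closed_word (last_nth (start_cfg s)) size_tuple /=.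
have -> : nth (start_cfg s) w m = tnth w i.
  rewrite (tnth_nth (start_cfg s)); congr nth.
  by apply/eqP; rewrite eqn_leq im -ltnS ltn_ord.
suff <- : k = 6 :> nat by rewrite b.
by apply/eqP; rewrite eqn_leq k6 -ltnS ltn_ord.
Qed.

(** Taking [F] constant 1 gives the number of maximal matchings, and taking the identity gives their
    total size. *)
Lemma sum_maximal_matchings (F : nat -> nat) :
  \sum_(M : {set {set G}} | maximal_matching M) F #|M| =
  \sum_(w : n.-tuple cfg | path (compatible s) (start_cfg s) w && closed_word w)
     F (\sum_(c <- w) weight c).
Proof.
rewrite (reindex_onto (fun w => edge_set (word_set w)) set_word) /=; last first.
  by move=> M /andP[/andP[sM _] _]; apply: set_wordK.
apply: eq_big => [w|w /andP[_]]; last by rewrite word_setK => /card_word_set->.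
by rewrite word_setK; apply: andb_id2r; apply: path_maximal.
Qed.

End Chain.

(** * The transfer matrices *)

Definition all_cfgs : seq cfg :=
  let b := [:: false; true] in let x A (s : seq A) := [seq (i, j) | i <- b, j <- s] in
  x _ (x _ (x _ (x _ (x _ (x _ b))))).

Lemma perm_all_cfgs : perm_eq (index_enum cfg) all_cfgs.
Proof.
apply: uniq_perm; first exact: index_enum_uniq.
  by vm_compute.
move=> c; rewrite mem_index_enum; apply/esym.
by case: c => [[] [[] [[] [[] [[] [[] []]]]]]].
Qed.

Lemma sum_cfg (P : pred cfg) (f : cfg -> nat) :
  \sum_(c | P c) f c = sumn [seq f c | c <- all_cfgs & P c].
Proof. by rewrite (perm_big _ perm_all_cfgs) -big_filter sumnE big_map. Qed.

Definition cfg_state_nat (s : nat) (c : cfg) : nat :=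
  if bit c 6 then 0 else if covers_exit s c then 1 else 2.

Lemma cfg_state_lt3 s c : cfg_state_nat s c < 3.
Proof. by rewrite /cfg_state_nat; case: ifP => // _; case: ifP. Qed.

Definition cfg_state s c : 'I_3 := Ordinal (cfg_state_lt3 s c).

(** Representatives of the states: the bridge alone, the start letter and, as the default of [nth],
    the empty letter. The start letter has state 1, so the chain itself is read off at coordinate
    1. *)
Definition state_cfg (s i : nat) : cfg :=
  nth (mkcfg xpred0) [:: mkcfg (eq_op 6); start_cfg s] i.

Section Transfer.
Variable s : nat.
Hypothesis s13 : (s == 1) || (s == 3).

Lemma bit6_state c : bit (state_cfg s (cfg_state s c)) 6 = bit c 6.
Proof.
rewrite [nat_of_ord _]/(cfg_state_nat s c) /cfg_state_nat; case: (bit c 6) => //.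
by case: covers_exit => //=; case/orP: s13 => /eqP->.
Qed.

Lemma covers_exit_state c : covers_exit s (state_cfg s (cfg_state s c)) = covers_exit s c.
Proof.
rewrite [nat_of_ord _]/(cfg_state_nat s c) /cfg_state_nat.
have [b6|_] := boolP (bit c 6); last first.
  by case: (covers_exit s c) => /=; case/orP: s13 => /eqP->.
(* A used bridge covers its own exit vertex, so state 0 also determines [covers_exit]. *)
have -> : covers_exit s c.
  by apply/hasP; exists 6 => //; rewrite b6; case/orP: s13 => /eqP->.
by case/orP: s13 => /eqP->.
Qed.

(** The preceding letter enters [compatible] only through its bridge bit and [covers_exit]. *)
Lemma compatible_state p c :
  compatible s p c = compatible s (state_cfg s (cfg_state s p)) c.
Proof. by rewrite /compatible bit6_state covers_exit_state. Qed.

(** For the empty word the last letter is [p] itself, so the initial counts depend on the bridge bit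
    of [p]. *)
Definition admissible n (p : cfg) (w : n.-tuple cfg) : bool :=
  path (compatible s) p w && ~~ bit (last p w) 6.

Definition word_count n p : nat := \sum_(w : n.-tuple cfg | admissible p w) 1.
Definition word_total n p : nat :=
  \sum_(w : n.-tuple cfg | admissible p w) \sum_(c <- w) weight c.

Lemma big_admissibleS n p (f : n.+1.-tuple cfg -> nat) :
  \sum_(w : n.+1.-tuple cfg | admissible p w) f w =
  \sum_(c | compatible s p c)
    \sum_(w : n.-tuple cfg | admissible c w) f [tuple of c :: w].
Proof.
rewrite pair_big_dep /=.
rewrite (reindex (fun x : cfg * n.-tuple cfg => [tuple of x.1 :: x.2])) /=; last first.
  exists (fun w : n.+1.-tuple cfg => (thead w, [tuple of behead w])) => [[c w] _|w _] /=.
    by congr (_, _); apply: val_inj.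
  by rewrite [RHS]tuple_eta.
by apply: eq_bigl => -[c w]; rewrite /admissible /= andbA.
Qed.

Lemma word_countS n p :
  word_count n.+1 p = \sum_(c | compatible s p c) word_count n c.
Proof. exact: big_admissibleS. Qed.

Lemma word_totalS n p : word_total n.+1 p =
  \sum_(c | compatible s p c) (word_total n c + weight c * word_count n c).
Proof.
rewrite /word_total big_admissibleS; apply: eq_bigr => c _.
under eq_bigr => w _ do rewrite big_cons.
by rewrite big_split /= addnC; congr (_ + _); rewrite /word_count big_distrr /= muln1.
Qed.

Lemma word_count_state n p : word_count n p = word_count n (state_cfg s (cfg_state s p)).
Proof.
case: n => [|n]; last by rewrite !word_countS; apply: eq_bigl => c; apply: compatible_state.
by apply: eq_bigl => w; rewrite /admissible tuple0 /= bit6_state.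
Qed.

Lemma word_total_state n p : word_total n p = word_total n (state_cfg s (cfg_state s p)).
Proof.
case: n => [|n]; last by rewrite !word_totalS; apply: eq_bigl => c; apply: compatible_state.
by apply: eq_bigl => w; rewrite /admissible tuple0 /= bit6_state.
Qed.

(** The matrix A is the case of [f] constant 1, and B the case of [f] equal to [weight]. *)
Definition transfer (f : cfg -> nat) (i j : 'I_3) : nat :=
  \sum_(c | compatible s (state_cfg s i) c && (cfg_state s c == j)) f c.

Lemma sum_compatible_state (f : cfg -> nat) (g : 'I_3 -> nat) (i : 'I_3) :
  \sum_(c | compatible s (state_cfg s i) c) f c * g (cfg_state s c) =
  \sum_j transfer f i j * g j.
Proof.
rewrite (partition_big (cfg_state s) xpredT) //=; apply: eq_bigr => j _.
by rewrite big_distrl /=; apply: eq_bigr => c /andP[_ /eqP->].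
Qed.

Lemma word_count_transfer n (i : 'I_3) : word_count n.+1 (state_cfg s i) =
  \sum_j transfer (fun=> 1) i j * word_count n (state_cfg s j).
Proof.
rewrite word_countS -(sum_compatible_state _ (fun j => word_count n (state_cfg s j))).
by apply: eq_bigr => c _; rewrite mul1n -word_count_state.
Qed.

Lemma word_total_transfer n (i : 'I_3) : word_total n.+1 (state_cfg s i) =
  \sum_j transfer (fun=> 1) i j * word_total n (state_cfg s j) +
  \sum_j transfer weight i j * word_count n (state_cfg s j).
Proof.
rewrite word_totalS -(sum_compatible_state _ (fun j => word_count n (state_cfg s j))).
rewrite -(sum_compatible_state _ (fun j => word_total n (state_cfg s j))) -big_split /=.
by apply: eq_bigr => c _; rewrite mul1n -word_count_state -word_total_state.
Qed.

Lemma word_count0 p : word_count 0 p = ~~ bit p 6.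
Proof.
rewrite /word_count (eq_bigl (fun=> ~~ bit p 6)) => [|w]; last by rewrite /admissible tuple0.
by case: bit => /=; rewrite ?big_pred0_eq // sum1_card card_tuple expn0.
Qed.

Lemma nb_maximal_matchings_hex_chain m :
  nb_maximal_matchings (hex_chain s m.+1) = word_count m.+1 (start_cfg s).
Proof.
rewrite /nb_maximal_matchings -sum1_card.
rewrite (eq_bigl (@maximal_matching (hex_chain s m.+1))) => [|M]; last by rewrite inE.
exact: (sum_maximal_matchings s13 m (fun=> 1)).
Qed.

Lemma total_maximal_matchings_hex_chain m :
  total_maximal_matchings (hex_chain s m.+1) = word_total m.+1 (start_cfg s).
Proof. exact: (sum_maximal_matchings s13 m id). Qed.

End Transfer.

(** * The explicit matrices for both kinds of chain *)

Definition table (t : seq (seq nat)) (i j : 'I_3) : nat := nth 0 (nth [::] t i) j.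

Lemma transfer1_count :
  transfer 1 (fun=> 1) =2 table [:: [:: 2; 2; 1]; [:: 3; 4; 1]; [:: 2; 3; 1]].
Proof.
by move=> [[|[|[|//]]] i] [[|[|[|//]]] j]; rewrite /transfer sum_cfg; vm_compute.
Qed.

Lemma transfer1_weight :
  transfer 1 weight =2 table [:: [:: 5; 4; 2]; [:: 9; 10; 2]; [:: 6; 8; 2]].
Proof.
by move=> [[|[|[|//]]] i] [[|[|[|//]]] j]; rewrite /transfer sum_cfg; vm_compute.
Qed.

Lemma transfer3_count :
  transfer 3 (fun=> 1) =2 table [:: [:: 1; 2; 1]; [:: 3; 4; 1]; [:: 2; 4; 0]].
Proof.
by move=> [[|[|[|//]]] i] [[|[|[|//]]] j]; rewrite /transfer sum_cfg; vm_compute.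
Qed.

Lemma transfer3_weight :
  transfer 3 weight =2 table [:: [:: 3; 4; 2]; [:: 9; 10; 2]; [:: 6; 10; 0]].
Proof.
by move=> [[|[|[|//]]] i] [[|[|[|//]]] j]; rewrite /transfer sum_cfg; vm_compute.
Qed.

(** * Growth of linear recurrences with a Perron eigenvalue *)

From mathcomp Require Import all_classical all_reals all_analysis.

Import Order.TTheory GRing.Theory Num.Theory.
Import numFieldNormedType.Exports.

Local Open Scope classical_set_scope.
Local Open Scope ring_scope.

(** * A norm adapted to the left eigenvector *)

Section WeightedNorm.
Variables (R : realType) (k : nat) (l : 'rV[R]_k).
Hypothesis l_gt0 : forall i, 0 < l 0 i.
Implicit Types (z : 'cV[R]_k) (A : 'M[R]_k).

Definition wnorm z : R := \sum_i l 0 i * `|z i 0|.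

Lemma wnorm_ge0 z : 0 <= wnorm z.
Proof. by apply: sumr_ge0 => i _; rewrite mulr_ge0 // ltW. Qed.

Lemma wnormD z z' : wnorm (z + z') <= wnorm z + wnorm z'.
Proof.
rewrite /wnorm -big_split /=; apply: ler_sum => i _.
by rewrite -mulrDr mxE ler_wpM2l ?ler_normD // ltW.
Qed.

Lemma norm_le_wnorm z i : `|z i 0| <= wnorm z / l 0 i.
Proof.
rewrite ler_pdivlMr // mulrC /wnorm (bigD1 i) //= lerDl.
by apply: sumr_ge0 => j _; rewrite mulr_ge0 // ltW.
Qed.

(** The column sums of [A] weighted by [l] are [t * l]; exchanging the two summations gives the
    factor [t]. *)
Lemma wnorm_mulmx A t z : (forall i j, 0 <= A i j) -> l *m A = t *: l ->
  wnorm (A *m z) <= t * wnorm z.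
Proof.
move=> A0 lA; rewrite /wnorm mulr_sumr.
have -> : \sum_j t * (l 0 j * `|z j 0|) = \sum_j \sum_i l 0 i * (A i j * `|z j 0|).
  apply: eq_bigr => j _; have /rowP/(_ j) := lA; rewrite !mxE => e.
  by rewrite mulrA -e mulr_suml; apply: eq_bigr => i _; rewrite mulrA.
rewrite exchange_big /=; apply: ler_sum => i _.
rewrite -mulr_sumr ler_wpM2l ?(ltW (l_gt0 _)) // mxE; apply: le_trans (ler_norm_sum _ _ _) _.
by apply: ler_sum => j _; rewrite normrM ger0_norm.
Qed.

(* Doeblin's argument: on the hyperplane [l z = 0] the row [c] of [A] may be
   decreased by [d l] without changing [A z]. *)
Lemma wnorm_contract A (c : 'I_k) d z : (forall i j, 0 <= A i j) ->
  (forall j, d * l 0 j <= A c j) -> l *m A = l -> l *m z = 0 ->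
  wnorm (A *m z) <= (1 - d * l 0 c) * wnorm z.
Proof.
move=> A0 Ac lA lz; pose A' := A - d *: (delta_mx c 0 *m l).
have -> : A *m z = A' *m z.
  by rewrite /A' mulmxBl -scalemxAl -mulmxA lz mulmx0 scaler0 subr0.
have Dij i j : (delta_mx c 0 *m l) i j = (i == c)%:R * l 0 j.
  by rewrite mxE big_ord1 mxE eqxx andbT.
(* [A'] is still nonnegative and has [l] as left eigenvector, now for the eigenvalue
   [1 - d * l 0 c]. *)
apply: wnorm_mulmx => [i j|].
  have -> : A' i j = A i j - d * (delta_mx c 0 *m l) i j by rewrite !mxE.
  by rewrite Dij; case: eqVneq => [->|_]; rewrite ?mul1r ?mul0r ?mulr0 ?subr0 // subr_ge0.
rewrite /A' mulmxBr lA -scalemxAr mulmxA.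
have -> : l *m delta_mx c 0 = (l 0 c)%:M.
  by apply/matrixP => i j; rewrite -colE !ord1 !mxE eqxx mulr1n.
by rewrite mul_scalar_mx scalerA scalerBl scale1r.
Qed.

Lemma functional_bounded (u : 'rV[R]_k) : exists K, forall z,
  0 <= K /\ `|(u *m z) 0 0| <= K * wnorm z.
Proof.
exists (\sum_i `|u 0 i| / l 0 i) => z; split.
  by apply: sumr_ge0 => i _; rewrite divr_ge0 // ltW.
rewrite mxE mulr_suml; apply: le_trans (ler_norm_sum _ _ _) _.
apply: ler_sum => i _; rewrite normrM -mulrA ler_wpM2l // mulrC.
exact: norm_le_wnorm.
Qed.

Lemma wnorm_mulmx_bounded A : exists K, forall z,
  0 <= K /\ wnorm (A *m z) <= K * wnorm z.
Proof.
have /all_sig[K KP] i : {K | forall z, 0 <= K /\ `|(row i A *m z) 0 0| <= K * wnorm z}.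
  exact/cid/functional_bounded.
exists (\sum_i l 0 i * K i) => z; split.
  by apply: sumr_ge0 => i _; rewrite mulr_ge0 ?(ltW (l_gt0 i)) //; case: (KP i z).
rewrite mulr_suml; apply: ler_sum => i _; rewrite -mulrA ler_wpM2l ?(ltW (l_gt0 _)) //.
by case: (KP i z) => _; rewrite -row_mul mxE.
Qed.

End WeightedNorm.

(** * Boundedness criteria for real sequences *)

Section Sequences.
Variable R : realType.

Lemma eq_cvgn (f g : nat -> R) (x : R) :
  f =1 g -> f @ \oo --> x -> g @ \oo --> x.
Proof. by move=> /funext ->. Qed.

Lemma affine_recurrence_bounded (t K : R) (x : nat -> R) : 0 <= t < 1 ->
  (forall n, x n.+1 <= t * x n + K) -> exists C, forall n, x n <= C.
Proof.
(* [K / (1 - t)] is the fixed point of the affine map, which does not increase any value above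
   it. *)
move=> /andP[t0 t1] xS; exists (Num.max (x 0%N) (K / (1 - t))); elim=> [|n IH].
  by rewrite le_max lexx.
rewrite (le_trans (xS n)) //.
have : K <= (1 - t) * Num.max (x 0%N) (K / (1 - t)).
  by rewrite mulrC -ler_pdivrMr ?subr_gt0 // le_max lexx orbT.
by move: IH; set C := Num.max _ _ => IH; nra.
Qed.

Lemma bounded_divn_cvg0 (x : nat -> R) (C : R) : (forall n, `|x n| <= C) ->
  (fun n => x n / n%:R) @ \oo --> 0.
Proof.
move=> xC; apply: norm_cvg0; rewrite -cvg_shiftS.
apply: (@squeeze_cvgr _ _ _ _ (fun=> 0) (fun n => C * harmonic n)).
- apply: nearW => n; rewrite normr_ge0 /= /harmonic /= normrM normfV normr_nat.
  by rewrite ler_wpM2r ?invr_ge0.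
- exact: cvg_cst.
- rewrite -[X in _ --> X](mulr0 C); apply: cvgM; [exact: cvg_cst|exact: cvg_harmonic].
Qed.

Lemma geometric_increments_bounded (t K : R) (x : nat -> R) : 0 <= t < 1 -> 0 <= K ->
  (forall n, `|x n.+1 - x n| <= K * t ^+ n) -> exists C, forall n, `|x n| <= C.
Proof.
move=> /andP[t0 t1] K0 xS; exists (`|x 0%N| + K / (1 - t)) => n.
have t1' : 0 < 1 - t by rewrite subr_gt0.
(* The partial geometric sum is the form of the bound that passes through the induction. *)
suff : `|x n| <= `|x 0%N| + K / (1 - t) * (1 - t ^+ n).
  move/le_trans; apply; rewrite lerD2l ler_piMr //; first by rewrite divr_ge0 // ltW.
  by rewrite gerBl exprn_ge0.
elim: n => [|n IH]; first by rewrite expr0 subrr mulr0 addr0.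
rewrite -(subrK (x n) (x n.+1)) (le_trans (ler_normD _ _)) //.
have -> : `|x 0%N| + K / (1 - t) * (1 - t ^+ n.+1) =
    K * t ^+ n + (`|x 0%N| + K / (1 - t) * (1 - t ^+ n)).
  by rewrite exprS; field; rewrite gt_eqF.
by rewrite lerD.
Qed.

End Sequences.

(** * Growth of totals relative to counts *)

Section Perron.
Variables (R : realType) (k : nat) (l : 'rV[R]_k) (h : 'cV[R]_k) (c : 'I_k).
Hypothesis l_gt0 : forall i, 0 < l 0 i.

(** Case of eigenvalue 1 and [l h = 1]. Split [v] and [w] into a multiple of [h] and a part in the
    kernel of [l], where [A] contracts. The kernel part of [v] decays geometrically, that of [w]
    stays bounded, and the coefficient of [w] along [h] grows linearly. *)
Lemma stochastic_growth (A B : 'M[R]_k) (v w : nat -> 'cV[R]_k) (d : R) :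
  l *m h = 1%:M ->
  (forall i j, 0 <= A i j) -> 0 < d -> (forall j, d * l 0 j <= A c j) ->
  l *m A = l -> A *m h = h -> 0 < h c 0 -> 0 < (l *m v 0%N) 0 0 ->
  (forall n, v n.+1 = A *m v n) ->
  (forall n, w n.+1 = A *m w n + B *m v n) ->
  (fun n => w n c 0 / (n%:R * v n c 0)) @ \oo --> (l *m B *m h) 0 0.
Proof.
move=> lh1 A0 d0 Ac lA Ah hc v0 vS wS.
pose t := 1 - d * l 0 c.
have t1 : t < 1 by rewrite gtrBl mulr_gt0.
have t0 : 0 <= t.
  (* Coordinate [c] of [l A = l] gives [l_c >= l_c A_cc >= l_c d l_c], hence [d l_c <= 1]. *)
  rewrite subr_ge0; have /rowP/(_ c) := lA; rewrite mxE (bigD1 c) //= => e.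
  rewrite -(ler_pM2l (l_gt0 c)) mulr1 -[leRHS]e -[leLHS]addr0 lerD //.
    by rewrite ler_wpM2l // ltW.
  by apply: sumr_ge0 => i _; rewrite mulr_ge0 // ltW.
have contr z : l *m z = 0 -> wnorm l (A *m z) <= t * wnorm l z.
  exact: wnorm_contract.
pose c0 := (l *m v 0%N) 0 0; pose b := (l *m B *m h) 0 0.
have scalE (u : 'M[R]_1) : u = (u 0 0)%:M by rewrite -mx11_scalar.
have lv n : l *m v n = c0%:M.
  by elim: n => [|n IH]; rewrite ?vS ?mulmxA ?lA //; apply: scalE.
pose z n := v n - c0 *: h.
have lz n : l *m z n = 0.
  by rewrite mulmxBr lv -scalemxAr lh1 scale_scalar_mx mulr1 subrr.
have zS n : z n.+1 = A *m z n by rewrite /z vS mulmxBr -scalemxAr Ah.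
have zt n : wnorm l (z n) <= wnorm l (z 0%N) * t ^+ n.
  elim: n => [|n IH]; first by rewrite mulr1.
  by rewrite zS (le_trans (contr _ (lz n))) // exprS mulrCA ler_wpM2l.
have vE n : v n = c0 *: h + z n by rewrite addrC subrK.
have zC n : wnorm l (z n) <= wnorm l (z 0%N).
  by rewrite (le_trans (zt n)) // ler_piMr ?wnorm_ge0 // exprn_ile1 // ltW.
pose a n := (l *m w n) 0 0.
pose y n := w n - a n *: h.
have lw n : l *m w n = (a n)%:M by exact: scalE.
have ly n : l *m y n = 0.
  by rewrite mulmxBr lw -scalemxAr lh1 scale_scalar_mx mulr1 subrr.
have aS n : a n.+1 = a n + (l *m B *m v n) 0 0.
  by rewrite /a wS mulmxDr mulmxA lA mxE mulmxA.
(* [P] is [B] followed by the projection along [h] onto the kernel of [l]. *)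
pose P := B - h *m (l *m B).
have yS n : y n.+1 = A *m y n + P *m v n.
  rewrite /y wS aS mulmxBr mulmxBl -scalemxAr Ah scalerDl opprD addrACA.
  congr (_ + (_ - _)).
  by rewrite -[RHS]mulmxA [in RHS](scalE (l *m B *m v n)) mul_mx_scalar.
have [Cy Cy_ge] : exists C, forall n, `|y n c 0| <= C.
  have [K PK] := wnorm_mulmx_bounded l_gt0 P.
  have [C yC] : exists C, forall n, wnorm l (y n) <= C.
    apply: (@affine_recurrence_bounded _ t
      (K * (wnorm l (c0 *: h) + wnorm l (z 0%N)))); first by rewrite t0.
    move=> n; rewrite yS (le_trans (wnormD _ _ _)) // lerD ?contr //.
    have [K0 PKv] := PK (v n); rewrite (le_trans PKv) // ler_wpM2l //.
    by rewrite vE (le_trans (wnormD _ _ _)) // lerD2l.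
  exists (C / l 0 c) => n; rewrite (le_trans (norm_le_wnorm l_gt0 _ _)) //.
  by rewrite ler_pM2r ?invr_gt0.
have [Ca Ca_ge] : exists C, forall n, `|a n - n%:R * (c0 * b)| <= C.
  have [K lK] := functional_bounded l_gt0 (l *m B).
  have [K0 _] := lK (z 0%N).
  apply: (@geometric_increments_bounded _ t (K * wnorm l (z 0%N))).
  - by rewrite t0.
  - by rewrite mulr_ge0 // wnorm_ge0.
  (* Subtracting the linear part leaves increments that see only [z n], hence are geometrically
     small. *)
  move=> n; have -> : a n.+1 - n.+1%:R * (c0 * b) - (a n - n%:R * (c0 * b)) =
      (l *m B *m z n) 0 0.
    rewrite aS vE mulmxDr -scalemxAr !mxE -/b -natr1 /b !mxE; ring.
  have [_ /le_trans] := lK (z n); apply; rewrite -mulrA ler_wpM2l //.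
have wE n : w n c 0 = n%:R * (c0 * b * h c 0) +
    (y n c 0 + (a n - n%:R * (c0 * b)) * h c 0).
  by rewrite /y !mxE; ring.
have eC n : `|y n c 0 + (a n - n%:R * (c0 * b)) * h c 0| <= Cy + Ca * h c 0.
  rewrite (le_trans (ler_normD _ _)) // lerD // normrM (ger0_norm (ltW hc)).
  by rewrite ler_wpM2r // ltW.
have wn : (fun n => w n c 0 / n%:R) @ \oo --> c0 * b * h c 0.
  rewrite -(cvg_shiftS (fun n => w n c 0 / n%:R)).
  pose e n := (y n c 0 + (a n - n%:R * (c0 * b)) * h c 0) / n%:R.
  have e0 : (fun n => e n.+1) @ \oo --> (0 : R).
    by rewrite (cvg_shiftS e); exact: bounded_divn_cvg0 eC.
  have H : (fun n => c0 * b * h c 0 + e n.+1) @ \oo --> c0 * b * h c 0 + 0.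
    by apply: cvgD; [exact: cvg_cst|exact: e0].
  rewrite addr0 in H; apply: eq_cvgn H => n /=.
  by rewrite wE mulrDl [_ * (c0 * b * h c 0)]mulrC mulfK ?pnatr_eq0.
have vn : (fun n => v n c 0) @ \oo --> c0 * h c 0.
  have z0 : (fun n => z n c 0) @ \oo --> (0 : R).
    apply: norm_cvg0.
    apply: (@squeeze_cvgr _ _ _ _ (fun=> 0) (geometric (wnorm l (z 0%N) / l 0 c) t)).
    - apply: nearW => n; rewrite normr_ge0 /= (le_trans (norm_le_wnorm l_gt0 _ _)) //.
      by rewrite mulrAC ler_pM2r ?invr_gt0.
    - exact: cvg_cst.
    - by apply: cvg_geometric; rewrite ger0_norm.
  have H : (fun n => c0 * h c 0 + z n c 0) @ \oo --> c0 * h c 0 + 0.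
    by apply: cvgD; [exact: cvg_cst|exact: z0].
  by rewrite addr0 in H; apply: eq_cvgn H => n; rewrite [in RHS]vE !mxE.
have c0h : c0 * h c 0 != 0 by rewrite mulf_neq0 // gt_eqF.
have -> : (l *m B *m h) 0 0 = c0 * b * h c 0 / (c0 * h c 0).
  by rewrite (mulrAC c0) [_ * b]mulrC mulfK.
apply: (@eq_cvgn _ (fun n => w n c 0 / n%:R * (v n c 0)^-1)) => [n|].
  by rewrite invfM mulrA.
by apply: cvgM => //; apply: cvgV.
Qed.

End Perron.

(** Dividing [A] and [B] by [r], the n-th vectors by [r ^+ n] and [h] by [l h] reduces to eigenvalue
    1; the quotient on the left is unchanged. *)
Lemma perron_growth (R : realType) (k : nat) (l : 'rV[R]_k) (h : 'cV[R]_k) (c : 'I_k)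
    (A B : 'M[R]_k) (v w : nat -> 'cV[R]_k) (r d : R) :
  (forall i, 0 < l 0 i) -> 0 < (l *m h) 0 0 -> (forall i j, 0 <= A i j) ->
  0 < d -> (forall j, d * l 0 j <= A c j) ->
  0 < r -> l *m A = r *: l -> A *m h = r *: h ->
  0 < h c 0 -> 0 < (l *m v 0%N) 0 0 ->
  (forall n, v n.+1 = A *m v n) ->
  (forall n, w n.+1 = A *m w n + B *m v n) ->
  (fun n => w n c 0 / (n%:R * v n c 0)) @ \oo -->
    (l *m B *m h) 0 0 / (r * (l *m h) 0 0).
Proof.
move=> l0 lh A0 d0 Ac r0 lA Ah hc lv vS wS.
set D := (l *m h) 0 0 in lh *.
have [rN DN] : r != 0 /\ D != 0 by rewrite !gt_eqF.
pose h' := D^-1 *: h; pose A' := r^-1 *: A; pose B' := r^-1 *: B.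
pose v' n := r ^- n *: v n; pose w' n := r ^- n *: w n.
have -> : (l *m B *m h) 0 0 / (r * D) = (l *m B' *m h') 0 0.
  have -> : l *m B' *m h' = (D^-1 * r^-1) *: (l *m B *m h).
    by rewrite /B' /h' -!scalemxAr -scalemxAl scalerA.
  by rewrite [RHS]mxE invfM mulrC [r^-1 * _]mulrC.
apply: (@eq_cvgn _ (fun n => w' n c 0 / (n%:R * v' n c 0))) => [n|].
  have -> : w' n c 0 = r ^- n * w n c 0 by rewrite mxE.
  have -> : v' n c 0 = r ^- n * v n c 0 by rewrite mxE.
  rewrite [n%:R * _]mulrCA invfM invrK mulrACA.
  by rewrite mulVf ?mul1r // expf_neq0.
apply: (@stochastic_growth _ _ _ _ _ _ A' B' v' w' (r^-1 * d)) => //.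
- by rewrite -scalemxAr [l *m h]mx11_scalar -/D scale_scalar_mx mulVf.
- by move=> i j; rewrite mxE mulr_ge0 // invr_ge0 ltW.
- by rewrite mulr_gt0 // invr_gt0.
- by move=> j; rewrite mxE -mulrA ler_pM2l // invr_gt0.
- by rewrite -scalemxAr lA scalerA mulVf // scale1r.
- by rewrite -scalemxAl -scalemxAr Ah !scalerA mulrAC mulVf // mul1r.
- by rewrite mxE mulr_gt0 // invr_gt0.
- by rewrite /v' expr0 invr1 scale1r.
- by move=> n; rewrite /v' vS -scalemxAl -scalemxAr scalerA exprS invfM.
- move=> n; rewrite /w' /v' wS scalerDr -!scalemxAl -!scalemxAr !scalerA exprS invfM //.
Qed.

(** * The limits *)

(** Positivity of the middle row, that of the start state, provides the minorization needed for
    contraction. The factor 3 comes from the matching number [3 * n]. *)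
Lemma matching_ratio_cvg (R : realType) (s : nat) (l h : 'I_3 -> R) (r : R) :
  (s == 1%N) || (s == 3%N) ->
  (forall i, 0 < l i) -> (forall i, 0 < h i) -> 0 < r ->
  (forall j, 0 < transfer s (fun=> 1%N) (Ordinal (isT : 1 < 3)%N) j)%N ->
  (forall j, \sum_i l i * (transfer s (fun=> 1%N) i j)%:R = r * l j) ->
  (forall i, \sum_j (transfer s (fun=> 1%N) i j)%:R * h j = r * h i) ->
  (fun n => matching_ratio (hex_chain s n) R) @ \oo -->
    (\sum_j (\sum_i l i * (transfer s weight i j)%:R) * h j) / (3 * (r * \sum_i l i * h i)).
Proof.
move=> s13 l0 h0 r0 A1 lA Ah.
pose c : 'I_3 := Ordinal (isT : 1 < 3)%N.
pose A : 'M[R]_3 := \matrix_(i, j) (transfer s (fun=> 1%N) i j)%:R.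
pose B : 'M[R]_3 := \matrix_(i, j) (transfer s weight i j)%:R.
pose L : 'rV[R]_3 := \row_i l i; pose H : 'cV[R]_3 := \col_i h i.
pose v n : 'cV[R]_3 := \col_i (word_count s n (state_cfg s i))%:R.
pose w n : 'cV[R]_3 := \col_i (word_total s n (state_cfg s i))%:R.
have l_le i : l i <= \sum_j l j.
  by rewrite (bigD1 i) //= lerDl; apply: sumr_ge0 => j _; rewrite ltW.
have sl0 : 0 < \sum_j l j by apply: lt_le_trans (l_le c).
have LH : (L *m H) 0 0 = \sum_i l i * h i.
  by rewrite mxE; apply: eq_bigr => i _; rewrite !mxE.
have LBH : (L *m B *m H) 0 0 = \sum_j (\sum_i l i * (transfer s weight i j)%:R) * h j.
  rewrite mxE; apply: eq_bigr => j _; rewrite !mxE; congr (_ * _).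
  by apply: eq_bigr => i _; rewrite !mxE.
rewrite -LBH -LH.
have lh0 : 0 < (L *m H) 0 0.
  rewrite LH (bigD1 c) //= ltr_pwDl ?mulr_gt0 //.
  by apply: sumr_ge0 => i _; rewrite mulr_ge0 // ltW.
have cv : (fun n => w n c 0 / (n%:R * v n c 0)) @ \oo -->
    (L *m B *m H) 0 0 / (r * (L *m H) 0 0).
  apply: (@perron_growth _ _ _ _ _ A B v w r (\sum_j l j)^-1) => //.
  - by move=> i; rewrite mxE.
  - by move=> i j; rewrite mxE.
  - by rewrite invr_gt0.
  (* With [d] the inverse of the sum of [l], [d * l j] is at most 1, and the positive integer
     entries of row [c] are at least 1. *)
  - move=> j; rewrite !mxE (@le_trans _ _ 1) ?ler1n //.
    by rewrite mulrC ler_pdivrMr // mul1r.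
  - apply/rowP => j; rewrite !mxE -lA; apply: eq_bigr => i _; by rewrite !mxE.
  - apply/colP => i; rewrite !mxE -Ah; apply: eq_bigr => j _; by rewrite !mxE.
  - by rewrite mxE.
  - have vc : v 0%N c 0 = 1.
      by rewrite mxE word_count0 /=; case/orP: s13 => /eqP->.
    rewrite mxE (bigD1 c) //= vc !mxE mulr1 ltr_pwDl //.
    by apply: sumr_ge0 => i _; rewrite !mxE mulr_ge0 // ltW.
  - move=> n; apply/colP => i; rewrite !mxE word_count_transfer // natr_sum.
    by apply: eq_bigr => j _; rewrite !mxE natrM.
  - move=> n; apply/colP => i; rewrite !mxE word_total_transfer // natrD !natr_sum.
    by congr (_ + _); apply: eq_bigr => j _; rewrite !mxE natrM.
(* The shift leaves out the empty chain, whose ratio is 1 by convention. *)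
rewrite -(cvg_shiftS (fun n => matching_ratio (hex_chain s n) R)).
apply: (@eq_cvgn _ (fun n => w n.+1 c 0 / (n.+1%:R * v n.+1 c 0) * 3^-1)) => [n|].
  rewrite /= /matching_ratio matching_number_hex_chain // -[_ == 0%N]/false.
  rewrite nb_maximal_matchings_hex_chain // total_maximal_matchings_hex_chain //.
  rewrite !mxE natrM -[state_cfg s c]/(start_cfg s) -!mulrA; congr (_ * _).
  by rewrite !invfM; ring.
rewrite invfM [3^-1 * _]mulrC mulrA; apply: cvgM; last exact: cvg_cst.
by rewrite (cvg_shiftS (fun n => w n c 0 / (n%:R * v n c 0))).
Qed.

(** Cardano's identity: the cube roots [a], [b] have product [k], and
    [(a + b)^3 = a^3 + b^3 + 3ab(a + b)]. The last bound is [4ab <= (a + b)^2]; it serves to bound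
    the root from below. *)
Lemma cube_root_sum (R : realType) (u v k : R) :
  0 <= u -> 0 <= v -> 0 <= k -> u * v = k ^+ 3 ->
  let x := u `^ 3^-1 + v `^ 3^-1 in
  [/\ x ^+ 3 = u + v + 3 * k * x, 0 <= x & 4 * k <= x ^+ 2].
Proof.
move=> u0 v0 k0 uv.
have cubeK (y : R) : 0 <= y -> (y `^ 3^-1) ^+ 3 = y.
  by move=> y0; rewrite -powR_mulrn ?powR_ge0 // -powRrM mulVf ?powRr1 // pnatr_eq0.
move: (cubeK u u0) (cubeK v v0) (powR_ge0 u 3^-1) (powR_ge0 v 3^-1).
set a := u `^ _; set b := v `^ _ => a3 b3 a0 b0 /=.
have ab : a * b = k.
  by apply/eqP; rewrite -(@eqrXn2 _ 3) ?mulr_ge0 // exprMn a3 b3 uv.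
split; [|by rewrite addr_ge0|].
  by rewrite -ab -[X in _ = X + _ + _]a3 -[X in _ = _ + X + _]b3; ring.
rewrite -ab -subr_ge0 (_ : _ - _ = (a - b) ^+ 2) ?sqr_ge0 //; ring.
Qed.

Ltac ord3 := case=> [[|[|[|//]]] ?].

Theorem theorem4 (R : realType) :
  (let r : R := (7 + (262 + 6 * Num.sqrt 129) `^ 3^-1
                   + (262 - 6 * Num.sqrt 129) `^ 3^-1) / 3 in
   (fun n : nat => matching_ratio (hex_chain 1 n) R) @ \oo -->
     (17 * r ^+ 2 - 13 * r + 8) / (3 * (7 * r ^+ 2 - 6 * r + 3))) /\
  (let r' : R := (5 + (359 + 12 * Num.sqrt 78) `^ 3^-1
                    + (359 - 12 * Num.sqrt 78) `^ 3^-1) / 3 in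
   (fun n : nat => matching_ratio (hex_chain 3 n) R) @ \oo -->
     (13 * r' ^+ 2 + 36 * r' + 28) / (3 * (5 * r' ^+ 2 + 16 * r' + 12))).
Proof.
split=> r.
  have q2 : Num.sqrt (129 : R) ^+ 2 = 129 by rewrite sqr_sqrtr.
  have q0 : 0 <= Num.sqrt (129 : R) by exact: sqrtr_ge0.
  (* Here [262^2 - 36 * 129 = 64000 = 40^3]. *)
  have [] := @cube_root_sum R (262 + 6 * Num.sqrt 129) (262 - 6 * Num.sqrt 129) 40.
  - lra.
  - nra.
  - by [].
  - ring: q2.
  set x := _ + _ => x3 x0 x2.
  have xE : x = 3 * r - 7 by rewrite /r -addrA -/x; field.
  (* From [x ^+ 2 >= 160] follows [x > 5]; the bound on [r] makes the eigenvectors below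
     positive. *)
  have r4 : 4 < r by nra.
  (* This is the characteristic equation of the counting matrix. *)
  have r3 : r ^+ 3 = 7 * r ^+ 2 - 3 * r + 1 by move: x3; rewrite xE; lra.
  move: r4 r3; clearbody r; clear => r4 r3.
  (* The eigenvectors are the middle row and column of the adjugate of [r - A]. *)
  pose l (i : 'I_3) := [:: 3 * r - 1; r ^+ 2 - 3 * r; r + 1]`_i.
  pose h (i : 'I_3) := [:: 2 * r + 1; r ^+ 2 - 3 * r; 3 * r - 2]`_i.
  have l0 i : 0 < l i by move: i; rewrite /l; ord3 => /=; nra.
  have h0 i : 0 < h i by move: i; rewrite /h; ord3 => /=; nra.
  have := @matching_ratio_cvg R 1 l h r isT l0 h0.
  rewrite !big_ord_recl !big_ord0 !transfer1_weight /table /l /h /=.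
  set y := _ / _; set y' := _ / _.
  (* After cross-multiplication the two quotients agree modulo the cubic equation. *)
  have <- : y = y'.
    rewrite /y /y'; apply/eqP; rewrite eqr_div; [|nra|nra].
    apply/eqP; ring: r3.
  apply; first by lra.
  - by ord3; rewrite transfer1_count.
  - by ord3; rewrite !big_ord_recl big_ord0 !transfer1_count /table /=; ring: r3.
  - by ord3; rewrite !big_ord_recl big_ord0 !transfer1_count /table /=; ring: r3.
  have q2 : Num.sqrt (78 : R) ^+ 2 = 78 by rewrite sqr_sqrtr.
  have q0 : 0 <= Num.sqrt (78 : R) by exact: sqrtr_ge0.
  (* Here [359^2 - 144 * 78 = 117649 = 49^3]. *)
  have [] := @cube_root_sum R (359 + 12 * Num.sqrt 78) (359 - 12 * Num.sqrt 78) 49.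
  - lra.
  - nra.
  - by [].
  - ring: q2.
  set x := _ + _ => x3 x0 x2.
  have xE : x = 3 * r - 5 by rewrite /r -addrA -/x; field.
  have r4 : 4 < r by nra.
  have r3 : r ^+ 3 = 5 * r ^+ 2 + 8 * r + 4 by move: x3; rewrite xE; lra.
  move: r4 r3; clearbody r; clear => r4 r3.
  (* Again the middle row and column of the adjugate of [r - A], for the second matrix. *)
  pose l (i : 'I_3) := [:: 3 * r + 2; r ^+ 2 - r - 2; r + 2]`_i.
  pose h (i : 'I_3) := [:: 2 * r + 4; r ^+ 2 - r - 2; 4 * r]`_i.
  have l0 i : 0 < l i by move: i; rewrite /l; ord3 => /=; nra.
  have h0 i : 0 < h i by move: i; rewrite /h; ord3 => /=; nra.
  have := @matching_ratio_cvg R 3 l h r isT l0 h0.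
  rewrite !big_ord_recl !big_ord0 !transfer3_weight /table /l /h /=.
  set y := _ / _; set y' := _ / _.
  have <- : y = y'.
    rewrite /y /y'; apply/eqP; rewrite eqr_div; [|nra|nra].
    apply/eqP; ring: r3.
  apply; first by lra.
  - by ord3; rewrite transfer3_count.
  - by ord3; rewrite !big_ord_recl big_ord0 !transfer3_count /table /=; ring: r3.
  - by ord3; rewrite !big_ord_recl big_ord0 !transfer3_count /table /=; ring: r3.
Qed.
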